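(* In the (universal) hyperbolic plane with absolute conic $\mathcal{N}\colon x_1^2+x_2^2-x_0^2=0$, let $$\mathcal{C}\colon \lambda(x_1^2+x_2^2-x_0^2) + (x_0+x_1)\bigl(\mu(x_0+x_1)+x_1\bigr) = 0,\qquad \lambda,\mu\in\mathbb{R},\ \lambda\neq 0,\ \lambda\neq-\tfrac12,$$ be a parabola tangent to $\mathcal{N}$ at $[1,-1,0]$. The Frégier locus of $\mathcal{C}$ is singular if and only if $\lambda=-1$. Thus the hyperbolic parabolas of this shape with singular Frégier locus form the one-parametric family $$\mathcal{C}\colon x_0^2-x_1^2-x_2^2+(x_0+x_1)\bigl(\mu(x_0+x_1)+x_1\bigr)=0,\qquad \mu\in\mathbb{R}.$$
   Context: Points have homogeneous coordinates $[x_0,x_1,x_2]$; points inside and outside $\mathcal{N}$ are treated equally, and the Frégier locus is considered in the complex projective plane. Two lines are orthogonal if they are conjugate with respect to $\mathcal{N}$ (one contains the pole of the other with respect to $\mathcal{N}$). A conic is regular if its symmetric coefficient matrix is invertible. A parabola is a conic $\mathcal{C}$ for which the pencil spanned by $\mathcal{C}$ and $\mathcal{N}$ has a single pair of coinciding base points (simple contact). For a regular conic $\mathcal{C}$ and $p\in\mathcal{C}$, the Frégier point $f(\mathcal{C},p)$ is the point common to the hypotenuses $q\vee r$ of all right triangles $p,q,r$ inscribed into $\mathcal{C}$ with right angle at $p$; equivalently, it is the pole with respect to $\mathcal{C}$ of the line joining the second intersection points with $\mathcal{C}$ of the two (possibly complex) tangents of $\mathcal{N}$ through $p$ (if these second intersection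 points coincide, the line is the tangent of $\mathcal{C}$ there; in particular $f(\mathcal{C},p)=p$ if $\mathcal{C}$ and $\mathcal{N}$ are tangent at $p$). The Frégier locus is $\mathcal{F}=\{f(\mathcal{C},p)\mid p\in\mathcal{C}\}$; it is called singular if it is not a regular conic.
   Formalization: In the final family μ = -1/2 is excluded: there the conic touches N at both [1,-1,0] and [1,1,0], so it is not a parabola as defined; its Frégier locus is still shown to be singular for every real μ. *)

(* Defs.v *)
From mathcomp Require Import all_boot all_order all_algebra.
From mathcomp Require Import boolp classical_sets reals.
From mathcomp Require Import complex ring.

Set Implicit Arguments.
Unset Strict Implicit.
Unset Printing Implicit Defensive.

Import Order.TTheory GRing.Theory Num.Theory.
Local Open Scope ring_scope.
Local Open Scope classical_set_scope.

(* A point of the projective plane over F is a nonzero row vector of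
   homogeneous coordinates, and a line a nonzero row vector of coefficients.
   Two such vectors represent the same point (or line) when they span the same
   row space, (x == y)%MS.  Sets of points are sets of nonzero vectors that are
   closed under nonzero scaling. *)

Definition qform (F : fieldType) (A : 'M[F]_3) (x : 'rV[F]_3) : F :=
  (x *m A *m x^T) 0 0.

Definition conic (F : fieldType) (A : 'M[F]_3) : set 'rV[F]_3 :=
  [set x | x != 0 /\ qform A x = 0].

(* Symmetric coefficient matrix of the quadratic form q, by polarization. *)
Definition coef_mx (F : fieldType) (q : 'rV[F]_3 -> F) : 'M[F]_3 :=
  \matrix_(i, j)
    ((q (delta_mx 0 i + delta_mx 0 j) - q (delta_mx 0 i) - q (delta_mx 0 j))
       / 2).

Definition incident (F : fieldType) (u x : 'rV[F]_3) : Prop :=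
  (u *m x^T) 0 0 = 0.

Definition joins (F : fieldType) (u x y : 'rV[F]_3) : Prop :=
  [/\ u != 0, incident u x & incident u y].

Definition is_pole (F : fieldType) (A : 'M[F]_3) (u x : 'rV[F]_3) : Prop :=
  x != 0 /\ (x *m A == u)%MS.

Definition tangent_at (F : fieldType) (A B : 'M[F]_3) (p : 'rV[F]_3) : Prop :=
  [/\ p \in conic A, p \in conic B & (p *m A == p *m B)%MS].

Definition absolute_eq (F : fieldType) (x : 'rV[F]_3) : F :=
  x 0 1 ^+ 2 + x 0 2 ^+ 2 - x 0 0 ^+ 2.

Definition absolute (F : fieldType) : 'M[F]_3 := coef_mx (@absolute_eq F).

Definition orthogonal (F : fieldType) (g h : 'rV[F]_3) : Prop :=
  exists x, is_pole (absolute F) g x /\ incident h x.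

(* The base points of the pencil spanned by C and the absolute conic are their
   common points.  As there are four of them with multiplicity, contact at p
   and exactly two further common points q and r mean that p is the only
   multiple base point, of multiplicity two. *)
Definition parabola (F : fieldType) (C : 'M[F]_3) : Prop :=
  exists p q r : 'rV[F]_3,
    [/\ tangent_at C (absolute F) p,
        [/\ ~~ (p == q)%MS, ~~ (p == r)%MS & ~~ (q == r)%MS] &
        conic C `&` conic (absolute F) =
          [set x | [|| (x == p)%MS, (x == q)%MS | (x == r)%MS]]].

Definition right_triangle (F : fieldType) (C : 'M[F]_3) (p q r : 'rV[F]_3) :
    Prop :=
  [/\ [/\ p \in conic C, q \in conic C & r \in conic C],
      [/\ ~~ (p == q)%MS, ~~ (p == r)%MS & ~~ (q == r)%MS] &
      exists g h, [/\ joins g p q, joins h p r & orthogonal g h]].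

(* f is the Fregier point of p with respect to a regular conic C.  If C is
   tangent to the absolute conic at p, there is no inscribed right triangle
   with right angle at p, and the Fregier point is p by convention. *)
Definition fregier_point (F : fieldType) (C : 'M[F]_3) (p f : 'rV[F]_3) :
    Prop :=
  [/\ f != 0,
      forall q r u, right_triangle C p q r -> joins u q r -> incident u f &
      tangent_at C (absolute F) p -> (f == p)%MS].

Definition fregier_locus (F : fieldType) (C : 'M[F]_3) : set 'rV[F]_3 :=
  [set f | exists2 p, p \in conic C & fregier_point C p f].

Definition regular_conic (F : fieldType) (S : set 'rV[F]_3) : Prop :=
  exists A : 'M[F]_3, [/\ A^T = A, A \in unitmx & S = conic A].

Definition singular (F : fieldType) (S : set 'rV[F]_3) : Prop :=
  ~ regular_conic S.

Definition contact_point (F : fieldType) : 'rV[F]_3 :=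
  \row_i [:: 1; -1; 0]`_i.

Definition tangent_conic_eq (F : fieldType) (lam mu : F) (x : 'rV[F]_3) : F :=
  lam * (x 0 1 ^+ 2 + x 0 2 ^+ 2 - x 0 0 ^+ 2)
  + (x 0 0 + x 0 1) * (mu * (x 0 0 + x 0 1) + x 0 1).

Definition special_conic_eq (F : fieldType) (mu : F) (x : 'rV[F]_3) : F :=
  x 0 0 ^+ 2 - x 0 1 ^+ 2 - x 0 2 ^+ 2
  + (x 0 0 + x 0 1) * (mu * (x 0 0 + x 0 1) + x 0 1).

(* Real coefficients, but viewed in the complex projective plane. *)
Definition tangent_conic (R : realType) (lam mu : R) : 'M[R[i]]_3 :=
  coef_mx (tangent_conic_eq lam%:C%C mu%:C%C).

Definition special_conic (R : realType) (mu : R) : 'M[R[i]]_3 :=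
  coef_mx (special_conic_eq mu%:C%C).

Lemma qformE (F : fieldType) (A : 'M[F]_3) (x : 'rV[F]_3) :
  qform A x = \sum_(i < 3) \sum_(j < 3) x 0 i * A i j * x 0 j.
Proof.
rewrite /qform mxE exchange_big /=; apply: eq_bigr => j _.
by rewrite !mxE mulr_suml.
Qed.

Lemma trmx_coef_mx (F : fieldType) (q : 'rV[F]_3 -> F) :
  (coef_mx q)^T = coef_mx q.
Proof.
apply/matrixP=> i j; rewrite !mxE (addrC (delta_mx 0 j)).
by rewrite -!addrA [- q _ - q _]addrC.
Qed.

Lemma sum_ord3 (F : fieldType) (f : 'I_3 -> F) :
  \sum_(i < 3) f i = f 0 + f 1 + f 2.
Proof.
rewrite !big_ord_recl big_ord0 addr0 addrA.
by congr (f _ + f _ + f _); apply: val_inj.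
Qed.

Lemma delta_mxE3 (F : fieldType) (j k : 'I_3) :
  (delta_mx 0 j : 'rV[F]_3) 0 k = (nat_of_ord k == nat_of_ord j)%:R.
Proof. by rewrite mxE eqxx. Qed.

(* The coefficient matrices represent the equations they are built from. *)

Lemma qform_absolute (F : numFieldType) (x : 'rV[F]_3) :
  qform (absolute F) x = absolute_eq x.
Proof.
rewrite qformE !sum_ord3 !mxE /absolute_eq.
rewrite ![fun_of_matrix (_ + _) _ _]mxE !delta_mxE3 /=.
by field.
Qed.

Lemma qform_tangent_eq (F : numFieldType) (lam mu : F) (x : 'rV[F]_3) :
  qform (coef_mx (tangent_conic_eq lam mu)) x = tangent_conic_eq lam mu x.
Proof.
rewrite qformE !sum_ord3 !mxE /tangent_conic_eq.
rewrite ![fun_of_matrix (_ + _) _ _]mxE !delta_mxE3 /=.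
by field.
Qed.

Lemma qform_special_eq (F : numFieldType) (mu : F) (x : 'rV[F]_3) :
  qform (coef_mx (special_conic_eq mu)) x = special_conic_eq mu x.
Proof.
rewrite qformE !sum_ord3 !mxE /special_conic_eq.
rewrite ![fun_of_matrix (_ + _) _ _]mxE !delta_mxE3 /=.
by field.
Qed.

Lemma qform_tangent_conic (R : realType) (lam mu : R) (x : 'rV[R[i]]_3) :
  qform (tangent_conic lam mu) x = tangent_conic_eq lam%:C%C mu%:C%C x.
Proof. exact: qform_tangent_eq. Qed.

Lemma qform_special_conic (R : realType) (mu : R) (x : 'rV[R[i]]_3) :
  qform (special_conic mu) x = special_conic_eq mu%:C%C x.
Proof. exact: qform_special_eq. Qed.

(* Main.v *)
Require Import Defs.
From mathcomp Require Import all_boot all_order all_algebra.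
From mathcomp Require Import boolp classical_sets reals.
From mathcomp Require Import complex.
From mathcomp Require Import ring.
Import Order.TTheory GRing.Theory Num.Theory.
Local Open Scope ring_scope.

(* With s = x0 + x1, d = x1 - x0 and y = x2, the conics involved all have the
   form a s d + b y^2 + c s^2 = 0: the absolute conic is (1, 1, 0) and the conic
   of the theorem is (lambda + 1/2, lambda, mu + 1/2).  Such a conic is
   parametrized by (s, y, d) = (a z^2, a t z, - (b t^2 + c z^2)), and orthogonality
   of the chords from the point t to the points u and v is a relation
   A u v + B (u + v) + C = 0.  As the coordinates of the chord from u to v
   are linear in (u v, u + v, 1), this relation says that the chord passes through
     (a b z^2, a (2 a - b) t z, - (b^2 t^2 + (4 a + b) c z^2)),
   which is therefore the Fregier point.  If 2 a <> b, this parametrizes a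
   regular conic of the same form; if 2 a = b, that is lambda = -1, the locus lies
   on the line y = 0 and has three different points. *)

Set Implicit Arguments.
Unset Strict Implicit.
Unset Printing Implicit Defensive.

(** * Row vectors, proportionality and incidence in coordinates *)

Definition vec3 (F : fieldType) (a b c : F) : 'rV[F]_3 :=
  \row_i [:: a; b; c]`_i.

Lemma vec3E (F : fieldType) (a b c : F) :
  (vec3 a b c 0 0 = a) * (vec3 a b c 0 1 = b) * (vec3 a b c 0 2 = c).
Proof. by rewrite !mxE. Qed.

Lemma rV3P (F : fieldType) (x y : 'rV[F]_3) :
  x 0 0 = y 0 0 -> x 0 1 = y 0 1 -> x 0 2 = y 0 2 -> x = y.
Proof.
move=> e0 e1 e2; apply/rowP=> -[[|[|[|//]]] lti].
- by rewrite (_ : Ordinal lti = 0) //; apply: val_inj.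
- by rewrite (_ : Ordinal lti = 1) //; apply: val_inj.
- by rewrite (_ : Ordinal lti = 2) //; apply: val_inj.
Qed.

Lemma eqmx_rV3P (F : fieldType) (x y : 'rV[F]_3) :
  (x == y)%MS <-> exists2 k, k != 0 & x = k *: y.
Proof.
split=> [/andP[/sub_rVP[k xE] /sub_rVP[l yE]]|[k k0 ->]].
  (* If the factor is 0, both vectors vanish and the factor 1 serves instead. *)
  have [k0|k0] := eqVneq k 0; last by exists k.
  by exists 1; rewrite ?oner_neq0// yE xE k0 !(scale0r, scaler0).
rewrite scalemx_sub//=.
by apply/sub_rVP; exists k^-1; rewrite scalerA mulVf// scale1r.
Qed.

Lemma incidentE (F : fieldType) (u x : 'rV[F]_3) :
  incident u x <-> u 0 0 * x 0 0 + u 0 1 * x 0 1 + u 0 2 * x 0 2 = 0.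
Proof. by rewrite /incident mxE sum_ord3 !mxE. Qed.

(** * Conics of the form [a s d + b y^2 + c s^2 = 0] *)

Definition axial_eq (F : fieldType) (a b c : F) (x : 'rV[F]_3) : F :=
  a * ((x 0 0 + x 0 1) * (x 0 1 - x 0 0)) + b * x 0 2 ^+ 2
  + c * (x 0 0 + x 0 1) ^+ 2.

Definition axial (F : fieldType) (a b c : F) : 'M[F]_3 :=
  coef_mx (axial_eq a b c).

Lemma qform_axial (F : numFieldType) (a b c : F) (x : 'rV[F]_3) :
  qform (axial a b c) x = axial_eq a b c x.
Proof.
rewrite qformE !sum_ord3 !mxE /axial_eq.
rewrite ![fun_of_matrix (_ + _) _ _]mxE !delta_mxE3 /=.
by field.
Qed.

Lemma mulmx_axial (F : numFieldType) (a b c : F) (x : 'rV[F]_3) :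
  x *m axial a b c =
  vec3 (c * (x 0 0 + x 0 1) - a * x 0 0) (c * (x 0 0 + x 0 1) + a * x 0 1)
    (b * x 0 2).
Proof.
by apply: rV3P; rewrite vec3E mxE sum_ord3 !mxE /axial_eq;
  rewrite ![fun_of_matrix (_ + _) _ _]mxE !delta_mxE3 /=; field.
Qed.

(** For a vector in the kernel the last entry gives [y = 0], and the difference of the first two
    gives [a s = 0]. With [s = 0] these two entries leave [a x0 = a x1 = 0]. *)
Lemma axial_unit (F : numFieldType) (a b c : F) :
  a != 0 -> b != 0 -> axial a b c \in unitmx.
Proof.
move=> a0 b0; rewrite -row_free_unit -kermx_eq0; apply/rowV0P => x /sub_kermxP.
rewrite mulmx_axial => xA.
have /rowP := xA.
move=> E; have := E 0; have := E 1; have := E 2.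
rewrite !vec3E !mxE => /eqP; rewrite mulf_eq0 (negPf b0) => /eqP x2 e1 e0.
have s0 : x 0 0 + x 0 1 = 0.
  apply: (mulfI a0); rewrite mulr0 -[RHS](subrr 0) -{1}e1 -e0; ring.
move: e0 e1; rewrite s0 !mulr0 !add0r => /eqP.
rewrite oppr_eq0 mulf_eq0 (negPf a0) => /eqP x0.
move=> /eqP; rewrite mulf_eq0 (negPf a0) => /eqP x1.
by apply: rV3P; rewrite ?mxE.
Qed.

Lemma absolute_axial (F : numFieldType) : absolute F = axial 1 1 0.
Proof.
rewrite /absolute /axial; congr coef_mx; apply/funext=> x.
by rewrite /absolute_eq /axial_eq; ring.
Qed.

Lemma tangent_conic_axial (F : numFieldType) (l m : F) :
  coef_mx (tangent_conic_eq l m) = axial (l + 1 / 2) l (m + 1 / 2).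
Proof.
rewrite /axial; congr coef_mx; apply/funext=> x.
by rewrite /tangent_conic_eq /axial_eq; field.
Qed.

Lemma special_conic_tangent (F : numFieldType) (m : F) :
  coef_mx (special_conic_eq m) = coef_mx (tangent_conic_eq (-1) m).
Proof.
congr coef_mx; apply/funext=> x.
by rewrite /tangent_conic_eq /special_conic_eq; ring.
Qed.

Lemma conic_axialP (F : numFieldType) (a b c : F) (x : 'rV[F]_3) :
  x \in conic (axial a b c) <-> x != 0 /\ axial_eq a b c x = 0.
Proof. by rewrite in_setE /conic /= qform_axial. Qed.

Lemma vec3_neq0 (F : fieldType) (a b c : F) :
  (vec3 a b c != 0) = [|| a != 0, b != 0 | c != 0].
Proof.
rewrite -!negb_and; congr negb; apply/eqP/and3P => [/rowP E|[/eqP-> /eqP-> /eqP->]].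
  by have := E 0; have := E 1; have := E 2; rewrite !vec3E !mxE => -> -> ->.
by apply: rV3P; rewrite vec3E mxE.
Qed.

(** * Orthogonality, and the parametrization of points, chords and Frégier points *)

Definition conj_form (F : fieldType) (g h : 'rV[F]_3) : F :=
  g 0 1 * h 0 1 + g 0 2 * h 0 2 - g 0 0 * h 0 0.

(** The pole of [g] is, up to scale, [g] with its first coordinate negated, because diag(-1, 1, 1)
    is its own inverse. Thus [conj_form], the dual form of the absolute conic, pairs this pole with
    [h]. *)
Lemma orthogonal_conj_form (F : numFieldType) (g h : 'rV[F]_3) : g != 0 ->
  Defs.orthogonal g h <-> conj_form g h = 0.
Proof.
move=> g0; rewrite /Defs.orthogonal /conj_form absolute_axial; split.
  move=> [x [[x0 /eqmx_rV3P[k k0]]]]; rewrite mulmx_axial => E /incidentE hx.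
  have /rowP E' := E; have := E' 0; have := E' 1; have := E' 2.
  rewrite !vec3E !mxE !mul1r !mul0r !add0r => x2 x1 x00.
  apply: (mulfI k0); rewrite mulr0 -hx x2 x1 -[x 0 0]opprK x00; ring.
move=> E; exists (vec3 (- g 0 0) (g 0 1) (g 0 2)); split.
  split.
    rewrite vec3_neq0 oppr_eq0 -vec3_neq0; apply: contraNneq g0 => /rowP e.
    by apply/eqP; apply: rV3P; [have := e 0|have := e 1|have := e 2];
      rewrite vec3E.
  apply/eqmx_rV3P; exists 1; rewrite ?oner_neq0// scale1r mulmx_axial.
  by apply: rV3P; rewrite !vec3E; ring.
by apply/incidentE; rewrite !vec3E -E; ring.
Qed.

(* To avoid halves, the point (s, y, d) is represented by the row
   (s - d, s + d, 2 y), that is by twice its coordinates. *)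
Definition conic_pt (F : fieldType) (a b c t z : F) : 'rV[F]_3 :=
  vec3 (a * z ^+ 2 + (b * t ^+ 2 + c * z ^+ 2))
    (a * z ^+ 2 - (b * t ^+ 2 + c * z ^+ 2)) (2 * a * t * z).

(** The cross product of the two parametrized points, divided by [2 a (t w - u z)]. Without this
    factor, equal parameters give the tangent. *)
Definition chord (F : fieldType) (a b c t z u w : F) : 'rV[F]_3 :=
  vec3 (c * z * w - b * t * u - a * z * w) (c * z * w - b * t * u + a * z * w)
    (b * (t * w + u * z)).

Definition fregier (F : fieldType) (a b c t z : F) : 'rV[F]_3 :=
  vec3 (a * b * z ^+ 2 + (b ^+ 2 * t ^+ 2 + (4 * a + b) * c * z ^+ 2))
    (a * b * z ^+ 2 - (b ^+ 2 * t ^+ 2 + (4 * a + b) * c * z ^+ 2))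
    (2 * a * (2 * a - b) * t * z).

Lemma vec3_sum0 (F : numFieldType) (s d y : F) :
  (vec3 (s + d) (s - d) y == 0) = [&& s == 0, d == 0 & y == 0].
Proof.
apply/eqP/and3P => [/rowP E|[/eqP-> /eqP-> /eqP->]]; last first.
  by apply: rV3P; rewrite vec3E mxE ?addr0 ?subr0.
have := E 0; have := E 1; have := E 2; rewrite !vec3E !mxE => -> e1 e0.
have s0 : s = 0.
  by rewrite (_ : s = (s + d + (s - d)) / 2); [rewrite e0 e1|]; field.
by split=> //; [rewrite s0|move: e0; rewrite s0 add0r => ->].
Qed.

Lemma conic_pt_neq0 (F : numFieldType) (a b c t z : F) : a != 0 -> b != 0 ->
  (conic_pt a b c t z != 0) = ((t, z) != (0, 0)).
Proof.
move=> a0 b0; rewrite vec3_sum0 xpair_eqE; congr negb.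
rewrite mulf_eq0 (negPf a0) sqrf_eq0 /=.
have [->|z0] := eqVneq z 0; last by rewrite andbF.
by rewrite expr0n !mulr0 addr0 mulf_eq0 (negPf b0) sqrf_eq0 eqxx !andbT.
Qed.

Lemma fregier_neq0 (F : numFieldType) (a b c t z : F) : a != 0 -> b != 0 ->
  (t, z) != (0, 0) -> fregier a b c t z != 0.
Proof.
move=> a0 b0; apply: contraNneq => /eqP; rewrite vec3_sum0 xpair_eqE.
rewrite !mulf_eq0 (negPf a0) (negPf b0) /= orbb => /and3P[/eqP-> + _].
by rewrite expr0n !mulr0 addr0 mulf_eq0 !sqrf_eq0 (negPf b0) eqxx andbT.
Qed.

(** A zero chord has [z w = 0] and [t w + u z = 0]. One term of the sum is then 0, hence so is the
    other, and they would be equal. *)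
Lemma chord_neq0 (F : numFieldType) (a b c t z u w : F) : a != 0 -> b != 0 ->
  t * w != u * z -> chord a b c t z u w != 0.
Proof.
move=> a0 b0; apply: contraNneq => /eqP.
rewrite /chord (_ : vec3 _ _ _ = vec3 ((c * z * w - b * t * u) + - (a * z * w))
  (c * z * w - b * t * u - - (a * z * w)) (b * (t * w + u * z))); last first.
  by congr vec3; rewrite opprK.
rewrite vec3_sum0 oppr_eq0 -mulrA !mulf_eq0 (negPf a0) (negPf b0) /=.
by case/and3P=> _ /orP[]/eqP->; rewrite !mulr0 ?addr0 ?add0r eq_sym.
Qed.

Lemma conic_pt_mem (F : numFieldType) (a b c t z : F) : a != 0 -> b != 0 ->
  (t, z) != (0, 0) -> conic_pt a b c t z \in conic (axial a b c).
Proof.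
move=> a0 b0 tz; apply/conic_axialP; rewrite conic_pt_neq0// /axial_eq !vec3E.
by split=> //; ring.
Qed.

(** Every vector is reached, not only one in each class, whence the square roots. If [s = 0], the
    equation forces [y = 0] and the point has [z = 0]. Otherwise [z] is found from [s = 2 a z^2],
    then [t] from [y], and the equation of the conic fixes [d]. *)
Lemma conic_pt_surj (F : numClosedFieldType) (a b c : F) (x : 'rV[F]_3) :
  a != 0 -> b != 0 -> x \in conic (axial a b c) ->
  exists t z, (t, z) != (0, 0) /\ x = conic_pt a b c t z.
Proof.
move=> a0 b0 /conic_axialP[x0 xC].
suff [t [z xE]] : exists t z, x = conic_pt a b c t z.
  by exists t, z; rewrite -(@conic_pt_neq0 _ a b c)// -xE.
have n2 : (2 : F) != 0 by rewrite pnatr_eq0.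
have [s0|s0] := eqVneq (x 0 0 + x 0 1) 0.
  move: xC; rewrite /axial_eq s0 mul0r expr0n !mulr0 add0r addr0 => /eqP.
  rewrite mulf_eq0 (negPf b0) sqrf_eq0 => /eqP x2.
  exists (sqrtC (x 0 0 / b)), 0; apply: rV3P; rewrite vec3E ?x2 ?sqrtCK.
  - by field.
  - by rewrite -[LHS](addKr (x 0 0)) s0; field.
  - by rewrite mulr0.
pose z := sqrtC ((x 0 0 + x 0 1) / (2 * a)).
have sE : x 0 0 + x 0 1 = 2 * a * z ^+ 2 by rewrite sqrtCK; field; rewrite ?a0 ?z0.
have z0 : z != 0.
  by apply: contraNneq s0 => z0; rewrite sE z0 expr0n mulr0.
pose t := x 0 2 / (2 * a * z).
have yE : x 0 2 = 2 * a * t * z by rewrite /t; field; rewrite ?a0 ?z0.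
have dE : x 0 1 - x 0 0 = - 2 * (b * t ^+ 2 + c * z ^+ 2).
  apply: (@mulfI _ (2 * a ^+ 2 * z ^+ 2)).
    by rewrite !mulf_neq0 ?expf_neq0.
  apply/eqP; rewrite -subr_eq0 -[X in _ == X]xC /axial_eq sE yE; apply/eqP; ring.
exists t, z; apply: rV3P; rewrite vec3E.
- rewrite (_ : x 0 0 = (x 0 0 + x 0 1 - (x 0 1 - x 0 0)) / 2); last by field.
  by rewrite sE dE; field.
- rewrite (_ : x 0 1 = (x 0 0 + x 0 1 + (x 0 1 - x 0 0)) / 2); last by field.
  by rewrite sE dE; field.
- exact: yE.
Qed.

(** Proportionality yields [z^2 = k w^2] and [t z = k u w], so that [z (t w) = z (u z)]. Conversely,
    the points are quadratic in the parameters, so the factor is the square of the ratio of the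
    parameters. *)
Lemma eqmx_conic_pt (F : numFieldType) (a b c t z u w : F) :
  a != 0 -> b != 0 -> (t, z) != (0, 0) -> (u, w) != (0, 0) ->
  (conic_pt a b c t z == conic_pt a b c u w)%MS = (t * w == u * z).
Proof.
move=> a0 b0 tz0 uw0; apply/idP/eqP => [/eqmx_rV3P[k k0 /rowP E]|E].
  have := E 0; have := E 1; have := E 2; rewrite !mxE /= => e2 e1 e0.
  have ez : z ^+ 2 = k * w ^+ 2.
    apply: (mulfI a0); rewrite (_ : a * z ^+ 2 =
      (a * z ^+ 2 + (b * t ^+ 2 + c * z ^+ 2) +
       (a * z ^+ 2 - (b * t ^+ 2 + c * z ^+ 2))) / 2).
      by rewrite e0 e1; field.
    by field.
  have ey : t * z = k * (u * w).
    apply: (@mulfI _ (2 * a)); first by rewrite mulf_neq0 ?pnatr_eq0.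
    by rewrite mulrA e2; ring.
  have [z0|z0] := eqVneq z 0.
    move: ez; rewrite z0 expr0n => /esym/eqP.
    by rewrite mulf_eq0 (negPf k0) sqrf_eq0 => /eqP->; rewrite !mulr0.
  apply: (mulfI z0); rewrite mulrA [z * t]mulrC ey.
  by rewrite (_ : z * (u * z) = u * z ^+ 2); [rewrite ez|]; ring.
apply/eqmx_rV3P.
have [z0|z0] := eqVneq z 0.
  have t0 : t != 0 by apply: contraNneq tz0 => ->; rewrite z0.
  move/eqP: E; rewrite z0 mulr0 mulf_eq0 (negPf t0) => /eqP w0.
  have u0 : u != 0 by apply: contraNneq uw0 => ->; rewrite w0.
  exists ((t / u) ^+ 2); first by rewrite expf_neq0// mulf_neq0 ?invr_eq0.
  by rewrite w0; apply: rV3P; rewrite !mxE /=; field.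
have w0 : w != 0.
  apply: contraNneq uw0 => w0; move/esym/eqP: E.
  by rewrite w0 mulr0 mulf_eq0 (negPf z0) orbF => /eqP->.
exists ((z / w) ^+ 2); first by rewrite expf_neq0// mulf_neq0 ?invr_eq0.
have -> : t = u * z / w by rewrite -E mulfK.
by apply: rV3P; rewrite !mxE /=; field.
Qed.

(** * Joining lines and the right-angle relation *)

Lemma rV3_colinear (F : fieldType) (x y : 'rV[F]_3) : y != 0 ->
  x 0 0 * y 0 1 = x 0 1 * y 0 0 -> x 0 0 * y 0 2 = x 0 2 * y 0 0 ->
  x 0 1 * y 0 2 = x 0 2 * y 0 1 -> exists k, x = k *: y.
Proof.
move=> y0 e01 e02 e12.
have [y00|y00] := eqVneq (y 0 0) 0; last first.
  exists (x 0 0 / y 0 0); apply: rV3P; rewrite mxE mulrAC ?mulfK//.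
  - by rewrite e01 mulfK.
  - by rewrite e02 mulfK.
have [y01|y01] := eqVneq (y 0 1) 0; last first.
  exists (x 0 1 / y 0 1); apply: rV3P; rewrite mxE mulrAC ?mulfK//.
  - by rewrite -e01 mulfK.
  - by rewrite e12 mulfK.
have [y02|y02] := eqVneq (y 0 2) 0.
  by case/eqP: y0; apply: rV3P; rewrite mxE.
exists (x 0 2 / y 0 2); apply: rV3P; rewrite mxE mulrAC ?mulfK//.
- by rewrite -e02 mulfK.
- by rewrite -e12 mulfK.
Qed.

Lemma joins_chord (F : numFieldType) (a b c t z u w : F) :
  a != 0 -> b != 0 -> t * w != u * z ->
  joins (chord a b c t z u w) (conic_pt a b c t z) (conic_pt a b c u w).
Proof.
move=> a0 b0 d0; split; first exact: chord_neq0.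
- by apply/incidentE; rewrite !vec3E; ring.
- by apply/incidentE; rewrite !vec3E; ring.
Qed.

Lemma joins_chord_inv (F : numFieldType) (a b c t z u w : F) (g : 'rV[F]_3) :
  a != 0 -> b != 0 -> t * w != u * z ->
  joins g (conic_pt a b c t z) (conic_pt a b c u w) ->
  exists2 k, k != 0 & g = k *: chord a b c t z u w.
Proof.
move=> a0 b0 d0 [g0 /incidentE gp /incidentE gq].
suff [k gE] : exists k, g = k *: chord a b c t z u w.
  by exists k => //; apply: contraNneq g0 => k0; rewrite gE k0 scale0r.
have K0 : 2 * a * (t * w - u * z) != 0.
  by rewrite !mulf_neq0 ?pnatr_eq0 ?subr_eq0.
(* Up to the factor [K0], the chord is the cross product of the two points, so
   [g] is parallel to it by the expansion of the triple product. *)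
pose ch := chord a b c t z u w; pose p := conic_pt a b c t z.
pose q := conic_pt a b c u w; pose K := 2 * a * (t * w - u * z).
have e2 : K * (g 0 0 * ch 0 1 - g 0 1 * ch 0 0) =
    p 0 2 * (g 0 0 * q 0 0 + g 0 1 * q 0 1 + g 0 2 * q 0 2) -
    q 0 2 * (g 0 0 * p 0 0 + g 0 1 * p 0 1 + g 0 2 * p 0 2).
  by rewrite !vec3E /K; ring.
have e1 : K * (g 0 0 * ch 0 2 - g 0 2 * ch 0 0) =
    q 0 1 * (g 0 0 * p 0 0 + g 0 1 * p 0 1 + g 0 2 * p 0 2) -
    p 0 1 * (g 0 0 * q 0 0 + g 0 1 * q 0 1 + g 0 2 * q 0 2).
  by rewrite !vec3E /K; ring.
have e0 : K * (g 0 1 * ch 0 2 - g 0 2 * ch 0 1) =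
    p 0 0 * (g 0 0 * q 0 0 + g 0 1 * q 0 1 + g 0 2 * q 0 2) -
    q 0 0 * (g 0 0 * p 0 0 + g 0 1 * p 0 1 + g 0 2 * p 0 2).
  by rewrite !vec3E /K; ring.
apply: rV3_colinear; first exact: chord_neq0.
- by apply/subr0_eq/(mulfI K0); rewrite e2 gp gq !mulr0 subrr.
- by apply/subr0_eq/(mulfI K0); rewrite e1 gp gq !mulr0 subrr.
- by apply/subr0_eq/(mulfI K0); rewrite e0 gp gq !mulr0 subrr.
Qed.

(** A polynomial identity: the incidence expression of hypotenuse and Frégier point is [- 2 a] times
    the dual form of the two legs. *)
Lemma incident_fregier (F : numFieldType) (a b c t z u w v x : F) : a != 0 ->
  incident (chord a b c u w v x) (fregier a b c t z) <->
  conj_form (chord a b c t z u w) (chord a b c t z v x) = 0.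
Proof.
move=> a0; rewrite incidentE.
have -> : chord a b c u w v x 0 0 * fregier a b c t z 0 0 +
    chord a b c u w v x 0 1 * fregier a b c t z 0 1 +
    chord a b c u w v x 0 2 * fregier a b c t z 0 2 =
  - (2 * a) * conj_form (chord a b c t z u w) (chord a b c t z v x).
  by rewrite /conj_form !vec3E; ring.
split=> [/eqP|->]; last by rewrite mulr0.
by rewrite mulf_eq0 oppr_eq0 mulf_eq0 pnatr_eq0 (negPf a0) => /eqP.
Qed.

(** * Points of tangency with the absolute conic *)

(** Let the two polars of the point be proportional with factor [k], and let [z <> 0]. The
    difference of the first two entries gives [k = a], the third gives [t = 0] because [a <> b], and
    what remains is [c s = 0]. *)
Lemma tangent_conic_pt (F : numFieldType) (a b c t z : F) :
  a != 0 -> b != 0 -> a != b -> (t, z) != (0, 0) ->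
  tangent_at (axial a b c) (absolute F) (conic_pt a b c t z) <->
  z = 0 \/ t = 0 /\ c = 0.
Proof.
move=> a0 b0 ab tz; rewrite absolute_axial /tangent_at.
have p0 := conic_pt_mem c a0 b0 tz.
have pS : conic_pt a b c t z 0 0 + conic_pt a b c t z 0 1 = 2 * a * z ^+ 2.
  by rewrite !vec3E; ring.
have pY : conic_pt a b c t z 0 2 = 2 * a * t * z by rewrite vec3E.
split=> [[_ _ /eqmx_rV3P[k k0]]|e].
  move: (conic_pt a b c t z) pS pY => p pS pY; rewrite !mulmx_axial => /rowP E.
  have := E 0; have := E 1; have := E 2.
  rewrite !vec3E ![fun_of_matrix (k *: _) _ _]mxE !vec3E pS.
  rewrite !mul0r !mul1r !add0r => e2 e1 e0.
  have [->|z0] := eqVneq z 0; [by left|right].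
  have S0 : 2 * a * z ^+ 2 != 0 by rewrite !mulf_neq0 ?expf_neq0 ?pnatr_eq0.
  have kE : k = a.
    apply: (mulfI S0); apply/subr0_eq.
    transitivity (k * p 0 1 - (k * - p 0 0) - a * (p 0 0 + p 0 1)).
      by rewrite pS -pS; ring.
    by rewrite -e0 -e1; ring.
  have t0 : t = 0.
    have : (b - a) * (2 * a * t * z) = 0 by rewrite -pY mulrBl e2 kE subrr.
    move/eqP; rewrite !mulf_eq0 subr_eq0 eq_sym (negPf ab) pnatr_eq0 (negPf a0).
    by rewrite (negPf z0) /= orbF => /eqP.
  split=> //; have /eqP : c * (2 * a * z ^+ 2) = 0.
    by apply/subr0_eq; rewrite subr0 -[LHS](subrK (a * p 0 0)) e0 kE; ring.
  by rewrite mulf_eq0 (negPf S0) orbF => /eqP.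
split=> //.
  apply/conic_axialP; split; first by rewrite conic_pt_neq0.
  by case: e => [->|[-> ->]]; rewrite /axial_eq !vec3E; ring.
apply/eqmx_rV3P; exists a => //; rewrite !mulmx_axial.
by case: e => [->|[-> ->]]; apply: rV3P; rewrite !mxE /= ?vec3E; ring.
Qed.

(** * Existence and uniqueness of the Frégier point *)

Lemma scale_incident (F : fieldType) (k : F) (u x : 'rV[F]_3) : k != 0 ->
  incident (k *: u) x <-> incident u x.
Proof.
move=> k0; rewrite /incident -scalemxAl mxE; split=> [/eqP|->]; last exact: mulr0.
by rewrite mulf_eq0 (negPf k0) => /eqP.
Qed.

Lemma conj_formZ (F : fieldType) (k l : F) (g h : 'rV[F]_3) :
  conj_form (k *: g) (l *: h) = k * l * conj_form g h.
Proof. by rewrite /conj_form !mxE; ring. Qed.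

Lemma fregier_pointP (F : numClosedFieldType) (a b c t z : F) :
  a != 0 -> b != 0 -> a != b -> (t, z) != (0, 0) ->
  fregier_point (axial a b c) (conic_pt a b c t z) (fregier a b c t z).
Proof.
move=> a0 b0 ab tz0; split; first exact: fregier_neq0.
  move=> q r l [[_ qC rC] [pq pr qr] [g [h [gj hj]]]] goh lj.
  have [u [w [uw0 qE]]] := conic_pt_surj a0 b0 qC.
  have [v [x [vx0 rE]]] := conic_pt_surj a0 b0 rC.
  move: pq pr qr gj hj lj; rewrite qE rE !eqmx_conic_pt// => pq pr qr gj hj lj.
  move: goh; rewrite orthogonal_conj_form; last by case: gj.
  have [k k0 ->] := joins_chord_inv a0 b0 pq gj.
  have [m m0 ->] := joins_chord_inv a0 b0 pr hj.
  have [n n0 ->] := joins_chord_inv a0 b0 qr lj.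
  rewrite conj_formZ => /eqP.
  rewrite !mulf_eq0 (negPf k0) (negPf m0) => /eqP.
  by rewrite scale_incident// incident_fregier.
rewrite tangent_conic_pt// => e.
(* At a point of tangency the formula returns [b] times the point itself. *)
apply/eqmx_rV3P; exists b => //.
by case: e => [->|[-> ->]]; apply: rV3P; rewrite !mxE /=; ring.
Qed.

(** The right-angle relation is solved for [v], with [u] outside the roots of a nonzero polynomial.
    The excluded values [e1] and [e2] allow a second triangle to be chosen away from a first one. *)
Lemma right_triangle_exists (F : numClosedFieldType) (a b c t z e1 e2 : F) :
  a != 0 -> b != 0 -> a != b -> z != 0 -> (t != 0) || (c != 0) ->
  exists u v, [/\ u != e1, u != e2,
    b ^+ 2 * z ^+ 2 * (u * v) =
      b * (2 * a - b) * t * z * (u + v) - (b ^+ 2 * t ^+ 2 + 4 * a * c * z ^+ 2)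
    & right_triangle (axial a b c) (conic_pt a b c t z)
        (conic_pt a b c u 1) (conic_pt a b c v 1)].
Proof.
move=> a0 b0 ab z0 tc.
(* The chords from [(t, z)] to [u] and [v] are orthogonal when [A u v + B (u + v) + C = 0]. *)
pose A := b ^+ 2 * z ^+ 2; pose B := - (b * (2 * a - b) * t * z).
pose C := b ^+ 2 * t ^+ 2 + 4 * a * c * z ^+ 2.
have A0 : A != 0 by rewrite mulf_neq0 ?expf_neq0.
have [AE BE CE] : [/\ A = b ^+ 2 * z ^+ 2, B = - (b * (2 * a - b) * t * z) &
  C = b ^+ 2 * t ^+ 2 + 4 * a * c * z ^+ 2] by [].
clearbody A B C.
have hlin (m n x : F) : (m *: 'X + n%:P).[x] = m * x + n.
  by rewrite hornerD hornerZ hornerX hornerC.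
have lin0 (m n : F) : (m != 0) || (n != 0) -> m *: 'X + n%:P != 0.
  apply: contraTneq => /polyP E; have := E 0; have := E 1.
  by rewrite !coefE !(mulr0, mulr1, addr0, add0r) => -> ->; rewrite eqxx.
(* The roots of [P] are the parameters [u] for which [v] below is undefined, for
   which two vertices of the triangle coincide, or which are excluded. *)
pose P : {poly F} := (A *: 'X + B%:P) * (z *: 'X + (- t)%:P) *
  ((A * t + B * z) *: 'X + (B * t + C * z)%:P) *
  (A *: 'X^2 + ((2 * B) *: 'X + C%:P)) * (1 *: 'X + (- e1)%:P) *
  (1 *: 'X + (- e2)%:P).
have : P != 0.
  rewrite !mulf_neq0 ?lin0 ?A0 ?z0 ?oner_neq0//.
    (* As [a <> b], this coefficient vanishes only for [t = 0]. Then the constant term is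
       [4 a c z^3], which is nonzero since [c <> 0]. *)
    have -> : A * t + B * z = 2 * b * z ^+ 2 * (b - a) * t by rewrite AE BE; ring.
    have [t0|t0] := eqVneq t 0; last first.
      by rewrite !mulf_neq0 ?expf_neq0 ?pnatr_eq0// subr_eq0 eq_sym.
    rewrite orbC t0 mulr0 add0r mulf_neq0// CE t0 expr0n mulr0 add0r.
    by rewrite t0 eqxx /= in tc; rewrite !mulf_neq0 ?expf_neq0 ?pnatr_eq0.
  apply: contraNneq A0 => /polyP /(_ 2).
  by rewrite !coefE /= !(mulr0, mulr1, addr0, add0r) => ->.
move/closed_nonrootP => [u]; rewrite /root /P !hornerM [(A *: 'X^2 + _).[_]]hornerD.
rewrite !hlin hornerZ hornerXn !mulf_eq0 !negb_or !mul1r.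
move=> /andP[/andP[/andP[/andP[/andP[u1 u2] u3] u4] u5] u6].
pose v := - (B * u + C) / (A * u + B).
exists u, v.
have rel : A * (u * v) = - B * (u + v) - C by rewrite /v; field.
have uv : u != v.
  apply: contraNneq u4 => uv; apply/eqP.
  transitivity (A * (u * v) + B * (u + v) + C); first by rewrite -uv; ring.
  by rewrite rel; ring.
have pq : t * 1 != u * z by rewrite mulr1 eq_sym mulrC -subr_eq0.
have pr : t * 1 != v * z.
  apply: contraNneq u3; rewrite mulr1 => tE; apply/eqP.
  transitivity ((A * (u * v) + B * (u + v) + C) * z); first by rewrite tE; ring.
  by rewrite rel; ring.
have qr : u * 1 != v * 1 by rewrite !mulr1.
have tz0 : (t, z) != (0, 0) by rewrite xpair_eqE negb_and z0 orbT.
have w0 (w : F) : (w, 1) != (0, 0) :> F * F.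
  by rewrite xpair_eqE negb_and oner_neq0 orbT.
split.
- by rewrite -subr_eq0.
- by rewrite -subr_eq0.
- by rewrite -AE rel BE opprK CE.
split.
- by split; apply: conic_pt_mem.
- by rewrite !eqmx_conic_pt.
exists (chord a b c t z u 1), (chord a b c t z v 1).
split; [exact: joins_chord|exact: joins_chord|].
apply/orthogonal_conj_form; first exact: chord_neq0.
transitivity (A * (u * v) + B * (u + v) + C).
  by rewrite /conj_form !vec3E AE BE CE; ring.
by rewrite rel; ring.
Qed.

Lemma fregier_point_unique (F : numClosedFieldType) (a b c t z : F)
    (f : 'rV[F]_3) :
  a != 0 -> b != 0 -> a != b -> (t, z) != (0, 0) ->
  fregier_point (axial a b c) (conic_pt a b c t z) f ->
  (f == fregier a b c t z)%MS.
Proof.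
move=> a0 b0 ab tz0 [f0 finc ftan].
have [/orP tan|] := boolP ((z == 0) || (t == 0) && (c == 0)).
  have {}tan : tangent_at (axial a b c) (absolute F) (conic_pt a b c t z).
    apply/tangent_conic_pt => //; case: tan => [/eqP|/andP[/eqP ? /eqP ?]].
      by left.
    by right.
  have [_ _ /(_ tan) g] := fregier_pointP c a0 b0 ab tz0.
  have /andP[l1 l2] := ftan tan; have /andP[l3 l4] := g.
  by rewrite (submx_trans l1 l4) (submx_trans l3 l2).
rewrite negb_or negb_and => /andP[z0 tc].
(* Two hypotenuses with different [u + v] determine their common point. *)
have [u [v [_ _ r1 T1]]] := right_triangle_exists 0 0 a0 b0 ab z0 tc.
have [u' [v' [uu uv r2 T2]]] := right_triangle_exists u v a0 b0 ab z0 tc.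
have hyp x y : right_triangle (axial a b c) (conic_pt a b c t z)
    (conic_pt a b c x 1) (conic_pt a b c y 1) ->
    (c - b * (x * y)) * (f 0 0 + f 0 1) + b * (x + y) * f 0 2
      + a * (f 0 1 - f 0 0) = 0.
  move=> T; have xy : x * 1 != y * 1.
    have [_ [_ _]] := T; rewrite eqmx_conic_pt// xpair_eqE negb_and;
      by rewrite oner_neq0 orbT.
  have /incidentE <- := finc _ _ _ T (joins_chord c a0 b0 xy).
  by rewrite !vec3E; ring.
pose S := f 0 0 + f 0 1; pose D := f 0 1 - f 0 0.
(* The right-angle relation eliminates the product [x y], so incidence with the hypotenuse becomes
   affine in the sum [x + y]. Two different sums force both coefficients to vanish. *)
have lin x y : right_triangle (axial a b c) (conic_pt a b c t z)
    (conic_pt a b c x 1) (conic_pt a b c y 1) ->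
    b ^+ 2 * z ^+ 2 * (x * y) =
      b * (2 * a - b) * t * z * (x + y) -
      (b ^+ 2 * t ^+ 2 + 4 * a * c * z ^+ 2) ->
    (b * c * z ^+ 2 + (b ^+ 2 * t ^+ 2 + 4 * a * c * z ^+ 2)) * S +
    a * b * z ^+ 2 * D =
    - (x + y) * (b * z * (b * z * f 0 2 - (2 * a - b) * t * S)).
  move=> T r; apply/subr0_eq.
  transitivity (b * z ^+ 2 * ((c - b * (x * y)) * S + b * (x + y) * f 0 2 + a * D)
    + (b ^+ 2 * z ^+ 2 * (x * y) - (b * (2 * a - b) * t * z * (x + y) -
      (b ^+ 2 * t ^+ 2 + 4 * a * c * z ^+ 2))) * S); first by ring.
  by rewrite r hyp// subrr mulr0 mul0r addr0.
(* By the right-angle relation the sum determines the product. With equal sums, [u'] would be a root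
   of the quadratic polynomial with roots [u] and [v], but it was chosen different from both. *)
have sums : u + v != u' + v'.
  apply: contraNneq uu => s.
  have e : u * v = u' * v'.
    apply: (@mulfI _ (b ^+ 2 * z ^+ 2)); first by rewrite mulf_neq0 ?expf_neq0.
    by rewrite r1 r2 s.
  have /eqP : (u' - u) * (u' - v) = 0.
    transitivity (u' ^+ 2 - (u + v) * u' + u * v); first by ring.
    by rewrite e s; ring.
  by rewrite mulf_eq0 [u' - v == 0]subr_eq0 (negPf uv) orbF subr_eq0.
have yE : b * z * f 0 2 - (2 * a - b) * t * S = 0.
  have : (u' + v' - (u + v)) *
      (b * z * (b * z * f 0 2 - (2 * a - b) * t * S)) = 0.
    by rewrite mulrBl -[X in X - _]opprK -mulNr -lin// (lin u v)//; ring.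
  move/eqP; rewrite mulf_eq0 subr_eq0 eq_sym (negPf sums) /=.
  by rewrite !mulf_eq0 (negPf b0) (negPf z0) => /eqP.
have dE := lin _ _ T1 r1.
rewrite yE !mulr0 in dE.
have n2 : (2 : F) != 0 by rewrite pnatr_eq0.
have f2 : f 0 2 = (2 * a - b) * t * S / (b * z).
  by rewrite -(subr0_eq yE); field; rewrite z0.
have fD : D = - (b * c * z ^+ 2 + (b ^+ 2 * t ^+ 2 + 4 * a * c * z ^+ 2)) * S /
    (a * b * z ^+ 2).
  apply/(canRL (mulfK _)); first by rewrite !mulf_neq0 ?expf_neq0.
  by rewrite mulNr mulrC; apply/eqP; rewrite -addr_eq0 addrC dE.
(* The factor comes from comparing the sums of the first two coordinates. *)
have fE : f = (S / (2 * a * b * z ^+ 2)) *: fregier a b c t z.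
  apply: rV3P; rewrite mxE vec3E.
  - rewrite (_ : f 0 0 = (S - D) / 2); last by rewrite /S /D; field.
    by rewrite fD; field; rewrite ?a0 ?b0 ?z0.
  - rewrite (_ : f 0 1 = (S + D) / 2); last by rewrite /S /D; field.
    by rewrite fD; field; rewrite ?a0 ?b0 ?z0.
  - by rewrite f2; field; rewrite ?a0 ?b0 ?z0.
apply/eqmx_rV3P; exists (S / (2 * a * b * z ^+ 2)) => //.
by apply: contraNneq f0 => k0; rewrite fE k0 scale0r.
Qed.

(** * The Frégier locus: its equation, and the regular and singular cases *)

(** For new parameters [T], [Z] the conditions [a Z^2 = a b z^2] and [a T Z = a (2 a - b) t z] give
    [Z], then [T]. The two new coefficients follow by matching the terms in [t^2] and [z^2] of
    [d]. *)
Lemma fregier_conic_pt (F : numClosedFieldType) (a b c t z : F) :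
  b != 0 -> 2 * a != b ->
  fregier a b c t z =
  conic_pt a (b ^+ 3 / (2 * a - b) ^+ 2) ((4 * a + b) * c / b)
    ((2 * a - b) / sqrtC b * t) (sqrtC b * z).
Proof.
move=> b0 ab; have ab0 : 2 * a - b != 0 by rewrite subr_eq0.
have s0 : sqrtC b != 0 by rewrite sqrtC_eq0.
have sb : sqrtC b ^+ 2 = b by rewrite sqrtCK.
have e1 : b ^+ 3 / (2 * a - b) ^+ 2 * ((2 * a - b) / sqrtC b * t) ^+ 2 =
    b ^+ 2 * t ^+ 2.
  by rewrite !exprMn exprVn sb; field; rewrite ?b0 ?ab0.
have e2 : (4 * a + b) * c / b * (sqrtC b * z) ^+ 2 = (4 * a + b) * c * z ^+ 2.
  by rewrite exprMn sb; field.
rewrite /fregier /conic_pt e1 e2 exprMn sb; congr vec3; by field.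
Qed.

Lemma conic_axialZ (F : numFieldType) (a b c k : F) (x : 'rV[F]_3) : k != 0 ->
  x \in conic (axial a b c) -> k *: x \in conic (axial a b c).
Proof.
move=> k0 /conic_axialP[x0 xC]; apply/conic_axialP; split.
  by rewrite scaler_eq0 negb_or k0.
transitivity (k ^+ 2 * axial_eq a b c x); last by rewrite xC mulr0.
by rewrite /axial_eq !mxE; ring.
Qed.

Lemma fregier_locus_axial (F : numClosedFieldType) (a b c : F) :
  a != 0 -> b != 0 -> a != b -> 2 * a != b ->
  fregier_locus (axial a b c) =
  conic (axial a (b ^+ 3 / (2 * a - b) ^+ 2) ((4 * a + b) * c / b)).
Proof.
move=> a0 b0 ab abl; have ab0 : 2 * a - b != 0 by rewrite subr_eq0.
have s0 : sqrtC b != 0 by rewrite sqrtC_eq0.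
pose b' := b ^+ 3 / (2 * a - b) ^+ 2.
have b'0 : b' != 0 by rewrite mulf_neq0 ?invr_eq0 ?expf_neq0.
apply/predeqP => x; split.
  move=> [p /(conic_pt_surj a0 b0)[t [z [tz0 ->]]]].
  move=> /(fregier_point_unique a0 b0 ab tz0)/eqmx_rV3P[k k0 ->].
  rewrite -in_setE; apply: conic_axialZ => //.
  rewrite fregier_conic_pt//; apply: conic_pt_mem => //.
  rewrite -(@conic_pt_neq0 _ a b' ((4 * a + b) * c / b))//.
  by rewrite -fregier_conic_pt// fregier_neq0.
rewrite -in_setE => /(conic_pt_surj a0 b'0)[t [z [tz0 ->]]].
(* The inverse of the rescaling in [fregier_conic_pt]. *)
pose t' := sqrtC b / (2 * a - b) * t; pose z' := z / sqrtC b.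
have tz0' : (t', z') != (0, 0).
  apply: contraNneq tz0 => -[/eqP + /eqP].
  by rewrite !mulf_eq0 !invr_eq0 (negPf s0) (negPf ab0) /= orbF => /eqP-> /eqP->.
have -> : conic_pt a b' ((4 * a + b) * c / b) t z = fregier a b c t' z'.
  rewrite fregier_conic_pt// /t' /z'; congr conic_pt; by field; rewrite ?s0 ?ab0.
by exists (conic_pt a b c t' z'); [exact: conic_pt_mem|exact: fregier_pointP].
Qed.

Lemma regular_fregier_locus (F : numClosedFieldType) (a b c : F) :
  a != 0 -> b != 0 -> a != b -> 2 * a != b ->
  regular_conic (fregier_locus (axial a b c)).
Proof.
move=> a0 b0 ab abl; rewrite fregier_locus_axial//.
exists (axial a (b ^+ 3 / (2 * a - b) ^+ 2) ((4 * a + b) * c / b)).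
split=> //; first exact: trmx_coef_mx.
by apply: axial_unit => //; rewrite mulf_neq0 ?invr_eq0 ?expf_neq0 ?subr_eq0.
Qed.

(** On the line [y = 0] the form of [A] is a binary quadratic form. It vanishes at three different
    points of the locus, hence identically, so the upper left block of [A] is zero and [A] is not
    invertible. *)
Lemma singular_fregier_locus (F : numClosedFieldType) (a c : F) :
  a != 0 -> singular (fregier_locus (axial a (2 * a) c)).
Proof.
move=> a0 [A [At Au lA]].
have n2 : (2 : F) != 0 by rewrite pnatr_eq0.
have b0 : 2 * a != 0 by rewrite mulf_neq0.
have ab : a != 2 * a by rewrite -subr_eq0 (_ : a - 2 * a = - a) ?oppr_eq0//; ring.
pose d (t z : F) := (2 * a) ^+ 2 * t ^+ 2 + 6 * a * c * z ^+ 2.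
have inA t z : (t, z) != (0, 0) -> let s := 2 * a ^+ 2 * z ^+ 2 in
    (A 0 0 + 2 * A 0 1 + A 1 1) * s ^+ 2 + 2 * (A 0 0 - A 1 1) * s * d t z +
    (A 0 0 - 2 * A 0 1 + A 1 1) * d t z ^+ 2 = 0.
  move=> tz0 s.
  have : conic A (fregier a (2 * a) c t z).
    rewrite -lA; exists (conic_pt a (2 * a) c t z); first exact: conic_pt_mem.
    exact: fregier_pointP.
  have A10 : A 1 0 = A 0 1 by rewrite -{1}At mxE.
  have -> : fregier a (2 * a) c t z = vec3 (s + d t z) (s - d t z) 0.
    by congr vec3; rewrite /s /d; ring.
  move=> [_]; rewrite qformE !sum_ord3 !vec3E A10 => <-; ring.
(* The parameter [(1, 0)] has [s = 0], which isolates the coefficient of [d^2]. *)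
have c0 : A 0 0 - 2 * A 0 1 + A 1 1 = 0.
  have /inA : (1, 0) != (0, 0) :> F * F by rewrite xpair_eqE negb_and oner_neq0.
  have d10 : d 1 0 = (2 * a) ^+ 2 by rewrite /d; ring.
  rewrite /= d10 expr0n !(mulr0, mul0r) expr0n !(mulr0, mul0r) !add0r => /eqP.
  by rewrite mulf_eq0 !expf_eq0 (negPf b0) orbF => /eqP.
have w0 (w : F) : (w, 1) != (0, 0) :> F * F.
  by rewrite xpair_eqE negb_and oner_neq0 orbT.
have := inA _ _ (w0 0); have := inA _ _ (w0 1).
rewrite /= c0 !mul0r !addr0 !expr1n !mulr1.
set s := 2 * a ^+ 2; have s0 : s != 0 by rewrite mulf_neq0 ?expf_neq0.
move=> e1 e2.
(* The parameters [(0, 1)] and [(1, 1)] share [s], while their values of [d] differ by [(2 a)^2].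
   Subtraction isolates the mixed coefficient. *)
have d0 : A 0 0 - A 1 1 = 0.
  have K0 : 2 * s * (2 * a) ^+ 2 != 0 by rewrite !mulf_neq0 ?expf_neq0.
  by apply: (mulfI K0); rewrite mulr0 -[RHS](subrr 0) -{1}e1 -e2 /d; ring.
have f0 : A 0 0 + 2 * A 0 1 + A 1 1 = 0.
  move/eqP: e1; rewrite d0 mulr0 !mul0r addr0 mulf_eq0 expf_eq0 (negPf s0).
  by rewrite orbF => /eqP.
have A11 : A 0 0 = A 1 1 by apply: subr0_eq.
have A01 : A 0 1 = 0.
  by rewrite (_ : A 0 1 = (A 0 0 + 2 * A 0 1 + A 1 1 -
      (A 0 0 - 2 * A 0 1 + A 1 1)) / 4);
    [rewrite f0 c0 subrr mul0r|field].
have A00 : A 0 0 = 0.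
  move: f0; rewrite A01 mulr0 addr0 -A11 => /eqP.
  by rewrite -mulr2n mulrn_eq0 => /eqP.
have A10 : A 1 0 = 0 by rewrite -At mxE.
have ker (x y : F) : x * A 0 2 + y * A 1 2 = 0 -> vec3 x y 0 = 0.
  move=> xy; apply: (can_inj (mulmxK Au)); rewrite mul0mx.
  apply: rV3P; rewrite mxE sum_ord3 !vec3E mxE -?A11 ?A00 ?A01.
  - by rewrite A10; ring.
  - by ring.
  - by rewrite mul0r addr0.
(* With a zero block, [(A 1 2, - A 0 2, 0)] lies in the kernel; should it be zero, then [(1, 0, 0)]
   does. *)
have [/eqP|] := eqVneq (vec3 (A 1 2) (- A 0 2) 0) 0.
  rewrite -[_ == 0]negbK vec3_neq0 oppr_eq0 eqxx orbF negb_or !negbK.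
  move=> /andP[_ /eqP A02].
  have /eqP : vec3 1 0 0 = 0 :> 'rV[F]_3 by rewrite ker// A02; ring.
  by rewrite -[_ == 0]negbK vec3_neq0 oner_neq0.
by rewrite ker ?eqxx//; ring.
Qed.

(** * Base points of the pencil, and parabolas *)

(** The absolute form at the parametrized point is [4 a z^2 ((a - b) t^2 - c z^2)]. The double
    factor [z^2] is the contact, and the other factor carries the remaining two base points. *)
Lemma conic_pt_absolute (F : numFieldType) (a b c t z : F) :
  a != 0 -> b != 0 -> (t, z) != (0, 0) ->
  conic_pt a b c t z \in conic (absolute F) <->
  z = 0 \/ (a - b) * t ^+ 2 = c * z ^+ 2.
Proof.
move=> a0 b0 tz0; rewrite absolute_axial.
have E : axial_eq 1 1 0 (conic_pt a b c t z) =
    4 * a * (z ^+ 2 * ((a - b) * t ^+ 2 - c * z ^+ 2)).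
  by rewrite /axial_eq !vec3E; ring.
split=> [/conic_axialP[_ /eqP]|e].
  rewrite E !mulf_eq0 orbb pnatr_eq0 (negPf a0) /= subr_eq0.
  by move=> /orP[]/eqP; [left|right].
apply/conic_axialP; split; first by rewrite conic_pt_neq0.
by rewrite E; case: e => ->; rewrite ?expr0n ?subrr !(mul0r, mulr0).
Qed.

Lemma conic_setIP (F : fieldType) (A B : 'M[F]_3) (x : 'rV[F]_3) :
  (conic A `&` conic B)%classic x <-> x \in conic A /\ x \in conic B.
Proof. by rewrite !in_setE. Qed.

(** If [c = 0], the only common points are those with [z = 0] or [t = 0], too few for three
    different ones. Otherwise the two further points have [t / z] equal to the square roots of
    [c / (a - b)]. *)
Lemma parabola_axial (F : numClosedFieldType) (a b c : F) :
  a != 0 -> b != 0 -> a != b -> parabola (axial a b c) <-> c != 0.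
Proof.
move=> a0 b0 ab; have ab0 : a - b != 0 by rewrite subr_eq0.
have z10 : (1, 0) != (0, 0) :> F * F by rewrite xpair_eqE negb_and oner_neq0.
have w0 (w : F) : (w, 1) != (0, 0) :> F * F.
  by rewrite xpair_eqE negb_and oner_neq0 orbT.
split.
  move=> [p [q [r [_ [pq pr qr] E]]]]; apply/eqP => c0.
  have on_axes (x : 'rV[F]_3) : [|| (x == p)%MS, (x == q)%MS | (x == r)%MS] ->
      (x == conic_pt a b c 1 0)%MS || (x == conic_pt a b c 0 1)%MS.
    move=> xE; have : (conic (axial a b c) `&` conic (absolute F))%classic x.
      by rewrite E.
    move=> /conic_setIP[/(conic_pt_surj a0 b0)[t [z [tz0 ->]]]].
    rewrite conic_pt_absolute// !eqmx_conic_pt// c0 !(mulr0, mul0r, mulr1, mul1r).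
    case=> [->|/eqP]; first by rewrite eqxx.
    by rewrite mulf_eq0 (negPf ab0) sqrf_eq0 => /= ->; rewrite orbT.
  have refl (x : 'rV[F]_3) : (x == x)%MS by rewrite submx_refl.
  have trans (x y z : 'rV[F]_3) :
      (x == z)%MS -> (y == z)%MS -> (x == y)%MS.
    by move=> /andP[xz zx] /andP[yz zy]; rewrite (submx_trans xz zy) (submx_trans yz zx).
  have := on_axes p; have := on_axes q; have := on_axes r.
  rewrite !refl !orbT => /(_ isT)/orP[]hr /(_ isT)/orP[]hq /(_ isT)/orP[]hp.
  - by rewrite (trans _ _ _ hp hq) in pq.
  - by rewrite (trans _ _ _ hq hr) in qr.
  - by rewrite (trans _ _ _ hp hr) in pr.
  - by rewrite (trans _ _ _ hp hq) in pq.
  - by rewrite (trans _ _ _ hp hq) in pq.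
  - by rewrite (trans _ _ _ hp hr) in pr.
  - by rewrite (trans _ _ _ hq hr) in qr.
  - by rewrite (trans _ _ _ hp hq) in pq.
move=> c0; pose s := sqrtC (c / (a - b)).
have s0 : s != 0 by rewrite sqrtC_eq0 mulf_neq0// invr_eq0.
have sE : (a - b) * s ^+ 2 = c by rewrite sqrtCK; field.
exists (conic_pt a b c 1 0), (conic_pt a b c s 1), (conic_pt a b c (- s) 1).
split.
- by apply/tangent_conic_pt => //; left.
- rewrite !eqmx_conic_pt// !mulr1 !mulr0 oner_neq0; split=> //.
  by rewrite -addr_eq0 -mulr2n mulrn_eq0.
apply/predeqP => x; split.
  move=> /conic_setIP[/(conic_pt_surj a0 b0)[t [z [tz0 ->]]]].
  rewrite /= conic_pt_absolute// !eqmx_conic_pt// !(mulr0, mulr1, mul1r).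
  case=> [->|]; first by rewrite eqxx.
  rewrite -sE -mulrA => /(mulfI ab0) /eqP.
  by rewrite -exprMn eqf_sqr mulNr => ->; rewrite orbT.
have inN t z : (t, z) != (0, 0) -> z = 0 \/ (a - b) * t ^+ 2 = c * z ^+ 2 ->
    (x == conic_pt a b c t z)%MS ->
    x \in conic (axial a b c) /\ x \in conic (absolute F).
  move=> tz0 tzN /eqmx_rV3P[k k0 ->]; split.
    by apply: conic_axialZ => //; apply: conic_pt_mem.
  rewrite absolute_axial; apply: conic_axialZ => //; rewrite -absolute_axial.
  exact/conic_pt_absolute.
move=> xE; apply/conic_setIP; case/or3P: xE; apply: inN => //; first by left.
- by right; rewrite sE expr1n mulr1.
- by right; rewrite sqrrN sE expr1n mulr1.
Qed.

Lemma tangent_at_contact_point (F : numFieldType) (a b c : F) : a != 0 ->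
  tangent_at (axial a b c) (absolute F) (contact_point F).
Proof.
move=> a0; rewrite absolute_axial -[contact_point F]/(vec3 1 (- 1) 0).
have p0 : vec3 1 (- 1) 0 != 0 :> 'rV[F]_3 by rewrite vec3_neq0 oner_neq0.
split; [| |apply/eqmx_rV3P; exists a => //].
- by apply/conic_axialP; split=> //; rewrite /axial_eq !vec3E; ring.
- by apply/conic_axialP; split=> //; rewrite /axial_eq !vec3E; ring.
by rewrite !mulmx_axial; apply: rV3P; rewrite !mxE /=; ring.
Qed.

(** * Return to the real parameters of the theorem *)

(** With [a = l + 1/2] and [b = l] one has [a - b = 1/2] and [2 a - b = l + 1]. *)
Lemma tangent_conic_coefs (R : realType) (lam : R) :
  lam != 0 -> lam != - (1 / 2) ->
  let l : R[i] := (lam%:C)%C in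
  [/\ l + 1 / 2 != 0, l != 0, l + 1 / 2 != l &
      (2 * (l + 1 / 2) == l) = (lam == -1)].
Proof.
move=> l0 l2 l.
have lE (m : R) : (l == (m%:C)%C) = (lam == m) by rewrite (inj_eq (@complexI R)).
have n2 : (2 : R[i]) != 0 by rewrite pnatr_eq0.
split.
- rewrite addr_eq0 (_ : - (1 / 2) = ((- (1 / 2) : R)%:C)%C) ?lE//.
  by rewrite rmorphN fmorph_div rmorph1 rmorph_nat.
- by rewrite (_ : 0 = (0%:C)%C) ?lE.
- by rewrite -subr_eq0 addrC addKr mulf_neq0 ?oner_neq0 ?invr_eq0.
by rewrite -lE rmorphN rmorph1 -subr_eq0 -[RHS]subr_eq0; congr (_ == _); field.
Qed.

Lemma singular_tangent_conic (R : realType) (lam mu : R) :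
  lam != 0 -> lam != - (1 / 2) ->
  singular (fregier_locus (tangent_conic lam mu)) <-> lam = -1.
Proof.
move=> l0 l2; have [a0 b0 ab E] := tangent_conic_coefs l0 l2.
rewrite /tangent_conic tangent_conic_axial; split=> [sing|/eqP].
  apply/eqP; rewrite -E; apply/negPn/negP => abl; apply: sing.
  exact: regular_fregier_locus.
by rewrite -E => /eqP {2}<-; apply: singular_fregier_locus.
Qed.

(** Here [c = mu + 1/2]. For [mu = - 1/2] the conic touches the absolute conic a second time, at
    [[1, 1, 0]]. *)
Lemma parabola_tangent_conic (R : realType) (lam mu : R) :
  lam != 0 -> lam != - (1 / 2) ->
  parabola (tangent_conic lam mu) <-> mu != - (1 / 2).
Proof.
move=> l0 l2; have [a0 b0 ab _] := tangent_conic_coefs l0 l2.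
rewrite /tangent_conic tangent_conic_axial parabola_axial//.
rewrite addr_eq0 (_ : - (1 / 2) = ((- (1 / 2) : R)%:C)%C).
  by rewrite (inj_eq (@complexI R)).
by rewrite rmorphN fmorph_div rmorph1 rmorph_nat.
Qed.

Lemma special_conicE (R : realType) (mu : R) :
  special_conic mu = tangent_conic (-1) mu.
Proof. by rewrite /tangent_conic rmorphN1; exact: special_conic_tangent. Qed.

Unset Implicit Arguments.
Set Strict Implicit.
Set Printing Implicit Defensive.

Theorem mainTheorem5 (R : realType) :
  (forall lam mu : R, lam != 0 -> lam != - (1 / 2) ->
     parabola (tangent_conic lam mu) ->
     tangent_at (tangent_conic lam mu) (absolute R[i]) (contact_point R[i]) ->
     (singular (fregier_locus (tangent_conic lam mu)) <-> lam = -1))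
  /\ (forall C : 'M[R[i]]_3,
        ((exists lam mu : R,
            [/\ lam != 0, lam != - (1 / 2) & C = tangent_conic lam mu])
         /\ parabola C
         /\ tangent_at C (absolute R[i]) (contact_point R[i])
         /\ singular (fregier_locus C))
        <-> exists mu : R, mu != - (1 / 2) /\ C = special_conic mu)
  /\ (forall mu : R, singular (fregier_locus (special_conic mu))).
Proof.
have m0 : (-1 : R) != 0 by rewrite oppr_eq0 oner_neq0.
have m2 : (-1 : R) != - (1 / 2).
  rewrite eqr_opp -subr_eq0 (_ : 1 - 1 / 2 = 1 / 2); last by field.
  by rewrite mulf_neq0 ?oner_neq0 ?invr_eq0 ?pnatr_eq0.
split; first by move=> lam mu l0 l2 _ _; exact: singular_tangent_conic.
split=> [C|mu]; last by rewrite special_conicE singular_tangent_conic.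
split=> [[[lam [mu [l0 l2 ->]]] [par [_ sing]]]|[mu [mu2 ->]]].
  exists mu; split; first exact/parabola_tangent_conic/par.
  by rewrite special_conicE (proj1 (singular_tangent_conic mu l0 l2) sing).
rewrite special_conicE; split; first by exists (-1), mu.
split; first exact/parabola_tangent_conic.
split; last exact/singular_tangent_conic.
have [a0 _ _ _] := tangent_conic_coefs m0 m2.
by rewrite /tangent_conic tangent_conic_axial; exact: tangent_at_contact_point.
Qed.
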